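(* If $\kappa$ is a completely ineffable cardinal, then $\mathfrak{b}_\kappa(\in^* )=\kappa^+$.
   Context: For $\kappa$ regular uncountable, a nonempty set $R\subseteq P(\kappa)$ is a stationary class if every $A\in R$ is a stationary subset of $\kappa$ and $R$ is upwards closed under inclusion (within $P(\kappa)$). $\kappa$ is completely ineffable if there is a stationary class $R$ such that for every $A\in R$ and every $F:[A]^2\to 2$ there is $B\in R$ such that $B\subseteq A$ and $F\restriction[B]^2$ is constant. A $\kappa$-slalom is a function $\varphi$ whose domain is a subset of $\kappa$ with bounded complement, such that $\varphi(\alpha)\subseteq\kappa$ and $|\varphi(\alpha)|=|\alpha|$ for all $\alpha\in\mathrm{dom}(\varphi)$ (values at finite $\alpha$ are irrelevant). For $f:\kappa\to\kappa$, write $f\in^*\varphi$ if $\{\alpha\in\mathrm{dom}(\varphi): f(\alpha)\notin\varphi(\alpha)\}$ is bounded in $\kappa$. $\mathfrak{b}_\kappa(\in^* )$ is the least cardinality of a family $\mathcal F\subseteq\kappa^\kappa$ such that for every $\kappa$-slalom $\varphi$ there is $f\in\mathcal F$ with $\neg(f\in^*\varphi)$. *)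

(* Defs.v *)
From mathcomp Require Import all_boot all_order.
From mathcomp Require Import boolp classical_sets functions cardinality wochoice.

Set Implicit Arguments.
Unset Strict Implicit.
Unset Printing Implicit Defensive.

Import Order.TTheory.
Local Open Scope card_scope.
Local Open Scope order_scope.
Local Open Scope classical_set_scope.

(* A cardinal kappa (an initial ordinal) is a well-ordered type K none of whose
   proper initial segments is equinumerous with K. A point a of K is the
   ordinal a < kappa, and, as a set of ordinals, is the segment below a.
   A subset of K is bounded when it satisfies the library's has_ubound. *)

Section Cardinals.

Definition card_lt (T U : Type) (A : set T) (B : set U) : Prop :=
  A #<= B /\ ~ (B #<= A).

Definition is_card_succ (T U : Type) (A : set T) (B : set U) : Prop :=
  card_lt A B /\ forall (V : Type) (C : set V), card_lt A C -> B #<= C.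

Context (d : Order.disp_t) (K : orderType d).

Definition segment (a : K) : set K := [set x | x < a].

Definition is_cardinal : Prop :=
  well_order (<=%O : rel K) /\ forall a : K, card_lt (segment a) [set: K].

Definition cofinal (A : set K) : Prop := forall x, exists2 y, A y & x <= y.

Definition regular_uncountable : Prop :=
  [/\ is_cardinal,
      ~ countable [set: K]
    & forall A : set K, cofinal A -> [set: K] #<= A].

End Cardinals.

Section Ineffability.
Context (d : Order.disp_t) (K : orderType d).

(* The two hypotheses on a say that a is a nonzero limit ordinal and that
   C is unbounded below a. *)
Definition closed_below_kappa (C : set K) : Prop :=
  forall a : K, (exists x, x < a) ->
    (forall x, x < a -> exists2 y, C y & x < y < a) -> C a.

Definition club (C : set K) : Prop :=
  closed_below_kappa C /\ ~ has_ubound C.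

Definition stationary (A : set K) : Prop :=
  forall C : set K, club C -> A `&` C !=set0.

Definition stationary_class (R : set (set K)) : Prop :=
  [/\ R !=set0,
      forall A, R A -> stationary A
    & forall A B, R A -> A `<=` B -> R B].

(* A colouring of the unordered pairs of K is read off a binary function F
   at the increasing pairs x < y; its other values play no role. *)
Definition constant_on_pairs (F : K -> K -> bool) (B : set K) : Prop :=
  exists i : bool, forall x y, B x -> B y -> x < y -> F x y = i.

Definition completely_ineffable : Prop :=
  regular_uncountable K /\
  exists2 R : set (set K), stationary_class R &
    forall (A : set K) (F : K -> K -> bool), R A ->
      exists B : set K, [/\ R B, B `<=` A & constant_on_pairs F B].

End Ineffability.

Section Slaloms.
Context (d : Order.disp_t) (K : orderType d).

(* A partial function: slalom_val is meaningful on slalom_dom only. *)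
Record slalom := Slalom {
  slalom_dom : set K;
  slalom_val : K -> set K;
  slalom_dom_cobounded : has_ubound (~` slalom_dom);
  slalom_card : forall a, slalom_dom a -> slalom_val a #= segment a }.

Definition captured (f : K -> K) (phi : slalom) : Prop :=
  has_ubound [set a | slalom_dom phi a /\ ~ slalom_val phi a (f a)].

Definition slalom_unbounded (F : set (K -> K)) : Prop :=
  forall phi : slalom, exists2 f, F f & ~ captured f phi.

(* F realizes the cardinal b_kappa(in-star): it is a slalom-unbounded family
   of least cardinality, so that this cardinal is the cardinality of F. *)
Definition realizes_b_in_star (F : set (K -> K)) : Prop :=
  slalom_unbounded F /\ forall G, slalom_unbounded G -> F #<= G.

End Slaloms.

Arguments completely_ineffable {d} K.
Arguments realizes_b_in_star {d} K F.

(* Main.v *)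
From HB Require Import structures.
From Stdlib Require Import Inverse_Image.
Require Import Defs.
From mathcomp Require Import all_boot all_order.
From mathcomp Require Import boolp classical_sets functions cardinality wochoice.

(** Write kappa for the cardinal of K and kappa^+ for its successor, realized
    here as a well-ordered type T that does not inject into K although all its
    proper initial segments do (exists_successor_order).

    At most kappa many functions g_b, b < kappa, never form an unbounded
    family: a slalom whose value at a contains g_b(a) for all b < a captures
    g_b beyond b (slalom_unbounded_not_small). Hence the bounding number is at
    least kappa^+, and it suffices to find one unbounded family of size
    kappa^+.

    The family is any sequence (f_x), x in T, that increases strictly modulo
    bounded sets; diagonalizing against kappa many functions at a time builds
    it (exists_increasing_chain). Suppose that a slalom phi captures every f_x
    and let p_a map the ordinals below a onto phi(a). Complete ineffability
    allows any family of relations, one on each a < kappa, to be made coherent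
    on a set B of the stationary class: for a < b in B the relation at a is the
    restriction of the one at b (coherent_refinement). Apply this first to the
    relation p_a(i) < p_a(j). The union of these relations over B is a
    well-founded relation W on kappa: a descending sequence lies below some a
    in B, so it is visible at a, where it would descend in the ordinals
    (limit_lt_minimum).

    Given x in T, enumerate the y <= x as e_j, j < kappa, and shrink B to B' so
    that the relations p_a(i) = f_{e_j}(a) cohere too. This turns e_j into an
    index k_j independent of a with f_{e_j}(a) = p_a(k_j) for large a in B'.
    As the f_y are eventually increasing, y |-> k_j (for y = e_j) embeds
    {y | y <= x} into W. So every initial segment of kappa^+ embeds into a
    well-founded relation on kappa, whence kappa^+ injects into kappa
    (card_le_of_embeddings), which is absurd. The class is what makes this work:
    B is fixed once, while B' depends on x and still lies inside B.

    This is the combinatorial content of the generic ultrapower by the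
    stationary class: coherence says that the ultrapower has no new subsets of
    kappa, so it cannot see phi collapse kappa^+. *)

Set Implicit Arguments.
Unset Strict Implicit.
Unset Printing Implicit Defensive.

Import Order.TTheory.
Local Open Scope card_scope.
Local Open Scope order_scope.
Local Open Scope classical_set_scope.

(** * Cardinality through coverings *)

Lemma card_le_cover (T U : Type) (A : set T) (B : set U) (f : U -> T) :
  A `<=` f @` B -> A #<= B.
Proof.
by move=> /subset_card_le AfB; apply: card_le_trans AfB (card_image_le _ _).
Qed.

Lemma cover_card_le (T U : Type) (t : T) (A : set T) (B : set U) :
  A #<= B -> exists f : U -> T, A `<=` f @` B.
Proof.
move=> /pfcard_geP [->|[f]]; first by exists (fun=> t).
by exists f => x Ax; have [y By <-] := 'surj_f Ax; exists y.
Qed.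

Lemma card_le_injective (T U : Type) (f : T -> U) (B : set U) :
  injective f -> (forall x, B (f x)) -> [set: T] #<= B.
Proof.
move=> f_inj fB; have fT : f @` [set: T] #= [set: T].
  by apply: inj_card_eq => x y _ _ /f_inj.
move: fT; rewrite card_eq_le => /andP[_] /card_le_trans; apply.
by apply: subset_card_le => _ [x _ <-].
Qed.

(** * Well-founded recursion and comparison of cardinals *)

(** Transfinite recursion in the form in which it is used throughout: at each
    stage, an element is chosen in terms of the set of the earlier ones, and it
    is enough to be able to choose for sets no larger than the segment. *)
Lemma recursive_choice (T U : Type) (lt : T -> T -> Prop)
    (P : set U -> U -> Prop) :
  well_founded lt ->
  (forall x (S : set U), S #<= [set y | lt y x] -> exists u, P S u) ->
  exists g : T -> U, forall x, P (g @` [set y | lt y x]) (g x).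
Proof.
move=> lt_wf exP.
have /choice[c cP] (xS : T * set U) :
    exists u, xS.2 #<= [set y | lt y xS.1] -> P xS.2 u.
  have [/exP[u Pu]|nle] := pselect (xS.2 #<= [set y | lt y xS.1]).
    by exists u.
  by have [u _] := exP xS.1 set0 (card_ge0 _ _); exists u => /nle.
pose step x (rec : forall y, lt y x -> U) : U :=
  c (x, [set u | exists y (yx : lt y x), u = rec y yx]).
pose g := Fix lt_wf (fun=> U) step.
have gE x : g x = c (x, g @` [set y | lt y x]).
  rewrite /g Fix_eq /step; last first.
    move=> z f1 f2 f12; congr (c (z, _)); apply/seteqP.
    by split=> u [y [yz ->]]; exists y, yz; rewrite f12.
  congr (c (x, _)); apply/seteqP; split=> u.
    by move=> [y [yx ->]]; exists y.
  by move=> [y yx <-]; exists y, yx.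
by exists g => x; rewrite gE; apply: (cP (x, _)); apply: card_image_le.
Qed.

(** The half of the comparability of cardinals that is needed: pick at each
    stage a new element of B, which the preceding choices cannot exhaust. *)
Lemma card_le_of_segments (T U : Type) (lt : T -> T -> Prop) (B : set U) :
  well_founded lt -> (forall x y, [\/ lt x y, x = y | lt y x]) ->
  (forall x, ~ (B #<= [set y | lt y x])) -> [set: T] #<= B.
Proof.
move=> lt_wf lt_tot nleB.
have [|g gP] := @recursive_choice T U lt (fun S u => B u /\ ~ S u) lt_wf.
  move=> x S Sx; apply/not_existsP => SB; apply: (nleB x).
  apply: card_le_trans Sx; apply: subset_card_le => u Bu.
  by apply: contrapT => nSu; apply: (SB u).
apply: (@card_le_injective _ _ g) => [x y gxy|x]; last by have [] := gP x.
have [xy|//|yx] := lt_tot x y.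
  by have [_ []] := gP y; exists x.
by have [_ []] := gP x; exists y.
Qed.

Lemma well_order_strict (T : Type) (R : rel T) (lt : T -> T -> Prop) :
  well_order R -> (forall x y, lt x y <-> ~~ R y x) ->
  [/\ well_founded lt, forall x y z, lt x y -> lt y z -> lt x z
    & forall x y, [\/ lt x y, x = y | lt y x]].
Proof.
move=> wo ltE.
have min (A : set T) x : A x -> exists2 m, A m & forall y, A y -> R m y.
  move=> Ax; have [|m [[/set_mem Am mA] _]] := wo (mem A).
    by exists x; rewrite inE.
  by exists m => // y Ay; apply: mA; rewrite inE.
have tot x y : R x y \/ R y x.
  have [|m [->|->] mA] := min [set x; y] x; first by left.
    by left; apply: mA; right.
  by right; apply: mA; left.
have anti x y : R x y -> R y x -> x = y.
  move=> xy yx; have xx : R x x by case: (tot x x).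
  have yy : R y y by case: (tot y y).
  have [|m [_ uniq]] := wo (mem [set x; y]).
    by exists x; rewrite inE; left.
  transitivity m; last apply: uniq; last first.
    by split; [rewrite inE; right|move=> z /set_mem[]->].
  by apply/esym/uniq; split; [rewrite inE; left|move=> z /set_mem[]->].
split.
- move=> x; apply: contrapT => nx.
  have [m nm mmin] := min [set z | ~ Acc lt z] x nx.
  apply: nm; constructor => y /ltE ym; apply: contrapT => ny.
  by move: ym; rewrite mmin.
- move=> x y z /ltE xy /ltE yz; apply/ltE/negP => zx.
  have [|m Am mmin] := min [set t | [\/ t = x, t = y | t = z]] x.
    by constructor 1.
  have [rx ry rz] : [/\ R m x, R m y & R m z].
    by split; apply: mmin; [constructor 1|constructor 2|constructor 3].
  case: Am => mE; move: rx ry rz; rewrite mE => rx ry rz.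
  + by move: yz; rewrite -(anti _ _ rz zx) ry.
  + by move: xy; rewrite rx.
  + by move: yz; rewrite ry.
- move=> x y; have [xy|/negP xy] := boolP (R x y); last first.
    by constructor 3; apply/ltE/negP.
  have [yx|/negP yx] := boolP (R y x).
    by constructor 2; apply: anti.
  by constructor 1; apply/ltE/negP.
Qed.

(** Well-order the power set of K, which is larger than K by Cantor's argument,
    and keep the points whose segment injects into K. They form an initial
    segment; if it injected into K, the least point outside it, whose segment
    it contains, would have been kept. *)
Lemma exists_successor_order (K : Type) :
  exists (T : Type) (lt : T -> T -> Prop),
    [/\ well_founded lt, forall x y z, lt x y -> lt y z -> lt x z,
        forall x y, [\/ lt x y, x = y | lt y x],
        forall x, [set y | lt y x] #<= [set: K]
      & ~ ([set: T] #<= [set: K])].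
Proof.
pose U : eqType := HB.pack (set K) (gen_eqMixin (set K)).
have [R /(@well_order_strict U R (fun x y => ~~ R y x)) []] :=
  well_ordering_principle U => //.
pose lt x y := ~~ R y x; rewrite -/lt => lt_wf lt_trans lt_tot.
pose small x := [set y | lt y x] #<= [set: K].
pose T := {x : U | small x}.
exists T, (fun x y => lt (val x) (val y)); split.
- exact: (@wf_inverse_image T U lt val lt_wf).
- by move=> x y z; apply: lt_trans.
- move=> x y; have [xy|/val_inj xy|yx] := lt_tot (val x) (val y);
    by [constructor 1|constructor 2|constructor 3].
- move=> x; apply: card_le_trans (valP x).
  apply: (@card_le_trans _ _ _ (val @` [set y : T | lt (val y) (val x)])).
    have := @inj_card_eq _ _ [set y : T | lt (val y) (val x)] val.
    by rewrite card_eq_le => /(_ (in2W val_inj))/andP[].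
  by apply: subset_card_le => _ [y yx <-].
- move=> TK.
  have [x nx] : exists x, ~ small x.
    apply/existsNP => allsmall.
    have UK : [set: U] #<= [set: K].
      apply: card_le_trans TK.
      apply: (@card_le_cover _ _ _ _ val) => x _.
      by exists (exist _ x (allsmall x)).
    have [e eU] := cover_card_le (set0 : U) UK.
    (* Cantor's diagonal set. *)
    have [k _ ek] := eU [set k | ~ (e k : set K) k] I.
    have ekk : (e k : set K) k <-> ~ (e k : set K) k by rewrite {1}ek.
    by have nk : ~ (e k : set K) k by [move=> h; apply/ekk: (h)]; apply/nk/ekk.
  elim/(well_founded_ind lt_wf): x nx => x IH; apply.
  apply: card_le_trans TK; apply: (@card_le_cover _ _ _ _ val) => y yx.
  have ys : small y by apply: contrapT => /(IH _ yx).
  by exists (exist _ y ys).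
Qed.

(** * Regular uncountable cardinals *)

Section Regular.
Context (d : Order.disp_t) (K : orderType d) (regK : regular_uncountable K).

Lemma regular_wf : well_founded (fun x y : K => x < y).
Proof.
have [[woK _] _ _] := regK.
have [|] := @well_order_strict K _ (fun x y => x < y) woK => //.
by move=> x y; rewrite ltNge.
Qed.

Lemma regular_minimum (A : set K) :
  A !=set0 -> exists2 m, A m & forall x, A x -> m <= x.
Proof.
move=> [x Ax]; apply: contrapT => nomin.
elim/(well_founded_ind regular_wf): x Ax => x IH Ax.
apply: nomin; exists x => // y Ay; rewrite leNgt; apply/negP => yx.
exact: IH Ay.
Qed.

Lemma strictly_bounded_image (I : Type) (A : set I) (f : I -> K) :
  ~ ([set: K] #<= A) -> exists b, forall i, A i -> f i < b.
Proof.
have [_ _ cofK] := regK => nKA; apply: contrapT => nb; apply: nKA.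
apply: card_le_trans (card_image_le f A); apply: cofK => x.
apply: contrapT => nx; apply: nb; exists x => i Ai.
by rewrite ltNge; apply/negP => xfi; apply: nx; exists (f i) => //; exists i.
Qed.

Lemma no_maximum (x : K) : exists y, x < y.
Proof.
have [|b xb] := @strictly_bounded_image unit setT (fun=> x).
  move=> Kfin; have [_ + _] := regK; apply.
  by apply: card_le_trans Kfin (finite_set_countable finite_finset).
by exists b; apply: (xb tt).
Qed.

Lemma inhabited_cardinal : exists x : K, True.
Proof.
have [_ unc _] := regK; apply: contrapT => noK; apply: unc.
by rewrite (_ : [set: K] = set0) // -subset0 => x _; apply: noK; exists x.
Qed.

Lemma bounded_on_segment (f : K -> K) (a : K) :
  exists b, forall x, x <= a -> f x < b.
Proof.
have [a' aa'] := no_maximum a; have [[_ segK] _ _] := regK.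
have [b fb] := strictly_bounded_image f (proj2 (segK a')).
by exists b => x xa; apply: fb; apply: le_lt_trans aa'.
Qed.

Lemma bounded_on_square (f : K -> K -> K) (a : K) :
  exists b, forall x y, x <= a -> y <= a -> f x y < b.
Proof.
have /choice[g gP] x := bounded_on_segment (f x) a.
have [b gb] := bounded_on_segment g a.
by exists b => x y xa ya; apply: lt_trans (gP x y ya) (gb x xa).
Qed.

Lemma bounded_sequence (f : nat -> K) : exists b, forall n, f n < b.
Proof.
have [_ unc _] := regK; have [b fb] := strictly_bounded_image f unc.
by exists b => n; apply: fb.
Qed.

(** Closing a point under u takes countably many steps, and the supremum of
    these stays below kappa because the cofinality is uncountable. *)
Lemma club_closure (u : K -> K) (a : K) :
  club [set x | a < x /\ forall i, i < x -> u i < x].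
Proof.
split=> [x [y yx] limx|[b bub]].
  split; first by have [z [az _] /andP[_ zx]] := limx y yx; apply: lt_trans zx.
  move=> i /limx[z [_ zu] /andP[iz zx]]; exact: lt_trans (zu i iz) zx.
have /choice[nxt nxtP] x : exists y, x < y /\ forall i, i <= x -> u i < y.
  have [b' ub'] := bounded_on_segment (fun i => Order.max x (u i)) x.
  exists b'; split=> [|i /ub']; last by rewrite gt_max => /andP[].
  by have := ub' x (lexx x); rewrite gt_max => /andP[].
(* Starting from b as well makes the limit exceed a supposed upper bound b. *)
pose s n := iter n nxt (Order.max a b).
have sS n : s n < s n.+1 by have [] := nxtP (s n).
have [|x xub xmin] := @regular_minimum [set x | forall n, s n < x].
  exact: bounded_sequence.
have : a < x /\ b < x.
  by have := xub 0%N; rewrite /s /= gt_max => /andP[].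
move=> [ax bx]; have : x <= b; last by rewrite leNgt bx.
apply: bub; split=> // i ix.
have [n isn] : exists n, i <= s n.
  apply: contrapT => ni; suff : x <= i by rewrite leNgt ix.
  apply: xmin => n; rewrite ltNge; apply/negP => isn.
  by apply: ni; exists n.
by apply: lt_trans (xub n.+1); have [_ ] := nxtP (s n); apply.
Qed.

Lemma stationary_closure_point (A : set K) (u : K -> K -> K) (a : K) :
  stationary A ->
  exists x, [/\ A x, a < x & forall i j, i < x -> j < x -> u i j < x].
Proof.
move=> stA; have /choice[v vP] := bounded_on_square u.
have [x [Ax [ax vx]]] := stA _ (club_closure v a).
exists x; split=> // i j ix jx.
apply: lt_trans (vP (Order.max i j) i j _ _) (vx _ _);
  rewrite ?le_max ?lexx ?orbT //.
by rewrite gt_max ix.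
Qed.

Lemma stationary_unbounded (A : set K) (a : K) :
  stationary A -> exists2 x, A x & a < x.
Proof.
move=> /(stationary_closure_point (fun i _ => i) a)[x [Ax ax _]].
by exists x.
Qed.

(** Successor ordinals below kappa^+ have size kappa too: the end segment of K
    above a point x0 is as large as K, which frees x0 to enumerate a. *)
Lemma card_le_add_point (T : Type) (A : set T) (a : T) :
  A #<= [set: K] -> a |` A #<= [set: K].
Proof.
move=> /(cover_card_le a)[e eA]; have [x0 _] := inhabited_cardinal.
have [_ _ /(_ [set x | x0 < x])] := regK.
move=> /(_ _)/(cover_card_le x0)[|q qK].
  move=> x; have [y] := no_maximum (Order.max x x0).
  by rewrite gt_max => /andP[xy x0y]; exists y => //; apply: ltW.
apply: (@card_le_cover _ _ _ _ (fun x => if x0 < x then e (q x) else a)).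
move=> t [->|/eA[y _ <-]]; first by exists x0; rewrite ?ltxx.
by have [x x0x <-] := qK y I; exists x; rewrite // x0x.
Qed.

End Regular.

(** * Few functions are captured by one slalom *)

Section Diagonal.
Context (d : Order.disp_t) (K : orderType d) (regK : regular_uncountable K).

(** A slalom must have values of size exactly |a|. The enumeration e is made
    injective by redirecting each repetition to a point above a bound of its
    range; no cardinal arithmetic is involved, so finite a are covered. *)
Lemma extend_to_card_segment (a : K) (e : K -> K) :
  exists S : set K, e @` segment a `<=` S /\ S #= segment a.
Proof.
have [_ _ cofK] := regK.
have [b eb] := bounded_on_segment regK e a.
have [x xb] : exists q : K -> K, forall y, b <= q y /\ injective q.
  have Kb : [set: K] #<= [set x | b <= x].
    apply: cofK => x; exists (Order.max b x); first by rewrite /= le_max lexx.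
    by rewrite le_max lexx orbT.
  have [q qK] := cover_card_le a Kb.
  have /choice[r rP] y : exists x, b <= x /\ q x = y.
    by have [x bx <-] := qK y I; exists x.
  exists r => y; split; first by case: (rP y).
  by move=> y1 y2 r12; have [_ <-] := rP y1; have [_ <-] := rP y2; rewrite r12.
pose new i := forall j, j < i -> e j <> e i.
pose g i := if `[< new i >] then e i else x i.
exists (g @` segment a); split.
  move=> y [i0 i0a ei0].
  have [|i ei imin] := @regular_minimum _ _ regK [set i | e i = y].
    by exists i0.
  exists i; first by apply: le_lt_trans i0a; apply: imin.
  rewrite /g asboolT // => j ji eji.
  by have := imin j; rewrite leNgt ji => /(_ (etrans eji ei)).
apply: inj_card_eq => i j; rewrite !inE => ia ja.
have xb1 y : b <= x y by case: (xb y).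
have x_inj : injective x by case: (xb a).
rewrite /g; case: asboolP => ni; case: asboolP => nj; last exact: x_inj.
- case: (ltgtP i j) => // [ij|ji] eij; first by case: (nj i).
  by case: (ni j).
- by move=> eij; have := eb i (ltW ia); rewrite eij ltNge xb1.
- by move=> eij; have := eb j (ltW ja); rewrite -eij ltNge xb1.
Qed.

Lemma slalom_unbounded_not_small (G : set (K -> K)) :
  slalom_unbounded G -> ~ (G #<= [set: K]).
Proof.
move=> unbG /(cover_card_le id)[g gG].
have /choice[S SP] a := extend_to_card_segment a (fun b => g b a).
have [x0 _] := inhabited_cardinal regK.
have domT : has_ubound (~` [set: K]).
  by exists x0 => x; rewrite setCT.
pose phi := Slalom domT (fun a _ => proj2 (SP a)).
have [f Gf] := unbG phi; apply; have [b _ <-] := gG f Gf.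
exists b => a [_ /= nSa]; rewrite leNgt; apply/negP => ba.
by apply: nSa; apply: (proj1 (SP a)); exists b.
Qed.

End Diagonal.

(** * Coherent sequences of relations *)

Section Coherence.
Context (d : Order.disp_t) (K : orderType d) (regK : regular_uncountable K).

(** The canonical well-order of pairs of ordinals. What matters here is that
    the predecessors of a pair lie in a bounded square. *)
Definition pair_lt (p q : K * K) : Prop :=
  let mp := Order.max p.1 p.2 in let mq := Order.max q.1 q.2 in
  mp < mq \/ mp = mq /\ (p.1 < q.1 \/ p.1 = q.1 /\ p.2 < q.2).

Lemma pair_lt_wf : well_founded pair_lt.
Proof.
suff acc m i j : Order.max i j = m -> Acc pair_lt (i, j).
  by move=> [i j]; apply: acc.
elim/(well_founded_ind (regular_wf regK)): m i j => m IHm i.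
elim/(well_founded_ind (regular_wf regK)): i => i IHi j.
elim/(well_founded_ind (regular_wf regK)): j => j IHj ijm.
constructor=> -[i' j'] [mm|[mm [ii|[ii jj]]]]; rewrite /= in mm *.
- by apply: IHm erefl; rewrite -ijm.
- by apply: IHi ii _ _; rewrite mm.
- by move: ii mm jj => /= -> mm jj; apply: IHj jj _; rewrite mm.
Qed.

Lemma pair_lt_total p q : [\/ pair_lt p q, p = q | pair_lt q p].
Proof.
case: p q => [i j] [i' j']; rewrite /pair_lt /=.
case: (ltgtP (Order.max i j) (Order.max i' j')) => [||mm].
- by constructor 1; left.
- by constructor 3; left.
case: (ltgtP i i') => [||ii]; [by constructor 1; right; split=> //; left|
  by constructor 3; right; split=> //; left|].
case: (ltgtP j j') => [||jj].
- by constructor 1; right; split=> //; right.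
- by constructor 3; right; split=> //; right.
- by constructor 2; rewrite ii jj.
Qed.

Lemma monotone_stabilizes (B : set K) (P : K -> Prop) (b : K) :
  (forall x y, B x -> B y -> b < x -> x < y -> P x -> P y) ->
  exists s, forall x y, B x -> B y -> s < x -> s < y -> P x <-> P y.
Proof.
move=> Pmono.
have [[x [Bx bx Px]]|nP] := pselect (exists x, [/\ B x, b < x & P x]).
  exists x => y z By Bz xy xz.
  by split=> _; apply: (Pmono x).
exists b => x y Bx By bx by_; split=> Pz; exfalso; apply: nP.
  by exists x.
by exists y.
Qed.

Definition lex_lt (S S' : set (K * K)) : Prop :=
  exists p, (forall q, pair_lt q p -> S q <-> S' q) /\ ~ S p /\ S' p.

(** By induction on p: from some point on, the sets X x with x in B agree below
    p, so a lexicographically increasing sequence can only gain the element p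
    and a non-increasing one can only lose it. Regularity bounds the stages
    reached for the predecessors of p. *)
Lemma lex_homogeneous_stabilizes (B : set K) (X : K -> set (K * K)) (c : bool) :
  (forall x y, B x -> B y -> x < y -> `[< lex_lt (X x) (X y) >] = c) ->
  forall p, exists s, forall x y, B x -> B y -> s < x -> s < y ->
    X x p <-> X y p.
Proof.
move=> lexc p; elim/(well_founded_ind pair_lt_wf): p => p IH.
have /choice[s sP] q : exists s, pair_lt q p ->
    forall x y, B x -> B y -> s < x -> s < y -> X x q <-> X y q.
  have [/IH[s sP]|nqp] := pselect (pair_lt q p); first by exists s.
  by exists p.1.
(* All predecessors of p have stabilized beyond b. *)
have [b bP] := bounded_on_square regK (fun i j => s (i, j)) (Order.max p.1 p.2).
have agree x y q : B x -> B y -> b < x -> b < y -> pair_lt q p ->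
    X x q <-> X y q.
  move=> Bx By bx by_ qp.
  have sb : s q < b.
    have : Order.max q.1 q.2 <= Order.max p.1 p.2.
      by case: qp => [/ltW//|[-> _]].
    by case: q {qp} => i j; rewrite ge_max => /andP[ip jp]; apply: bP.
  by apply: sP => //; apply: lt_trans sb _.
case: c lexc => lexc.
  apply: (@monotone_stabilizes B (fun x => X x p) b) => x y Bx By bx xy Xxp.
  have /asboolP[r [agr [nXr Xr]]] := lexc x y Bx By xy.
  have [rp|rp|pr] := pair_lt_total r p.
  - by case: nXr; apply/(agree x y) => //; apply: lt_trans xy.
  - by move: nXr; rewrite rp.
  - exact/(agr p pr).
have [z zP] : exists z, forall x y, B x -> B y -> z < x -> z < y ->
    ~ X x p <-> ~ X y p.
  apply: (@monotone_stabilizes B (fun x => ~ X x p) b).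
  move=> x y Bx By bx xy nXxp Xyp.
  have /asboolP := negbT (lexc x y Bx By xy); apply; exists p; split=> //.
  by move=> q qp; apply: agree => //; apply: lt_trans xy.
exists z => x y Bx By zx zy; have := zP x y Bx By zx zy.
by move=> [nxy nyx]; split=> Xp; apply: contrapT; [move=> /nyx|move=> /nxy].
Qed.

(** Colour a pair x < y by whether the relation at x is the restriction of the
    one at y. A homogeneous set of the other colour cannot occur: it would
    have a subset in R on which the relations are lexicographically monotone,
    hence stabilize pointwise, and at a point x closed under the stabilization
    stages the relation at x agrees below x with all later ones. *)
Lemma coherent_refinement (R : set (set K)) :
  stationary_class R ->
  (forall (A : set K) (F : K -> K -> bool), R A ->
     exists B : set K, [/\ R B, B `<=` A & constant_on_pairs F B]) ->
  forall (A : set K) (X : K -> K -> K -> Prop), R A ->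
  exists B, [/\ R B, B `<=` A & forall x y, B x -> B y -> x < y ->
    forall i j, i < x -> j < x -> X x i j <-> X y i j].
Proof.
move=> [_ Rstat _] hom A X RA.
pose coh x y := forall i j, i < x -> j < x -> X x i j <-> X y i j.
have [B [RB BA [[] Bcoh]]] := hom A (fun x y => `[< coh x y >]) RA.
  by exists B; split=> // x y Bx By xy; apply/asboolP/Bcoh.
pose Y x : set (K * K) := [set p | X x p.1 p.2].
have [B' [RB' B'B [c /lex_homogeneous_stabilizes stab]]] :=
  hom B (fun x y => `[< lex_lt (Y x) (Y y) >]) RB.
have /choice[s sP] := stab.
have [x0 _] := inhabited_cardinal regK.
(* Beyond x, membership of any pair of points below x is already decided. *)
have [x [B'x _ sx]] :=
  stationary_closure_point regK (fun i j => s (i, j)) x0 (Rstat _ RB').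
have [y B'y xy] := stationary_unbounded regK x (Rstat _ RB').
have /negP[] := negbT (Bcoh x y (B'B x B'x) (B'B y B'y) xy).
apply/asboolP => i j ix jx; have sxij := sx i j ix jx.
by apply: (sP (i, j)) => //; apply: lt_trans xy.
Qed.

End Coherence.

(** * A chain of functions that no slalom captures *)

Section Chain.
Context (d : Order.disp_t) (K : orderType d) (regK : regular_uncountable K).

Definition eventually_lt (f g : K -> K) : Prop :=
  exists t, forall a, t < a -> f a < g a.

Lemma small_family_dominated (S : set (K -> K)) :
  S #<= [set: K] -> exists g, forall f, S f -> eventually_lt f g.
Proof.
move=> /(cover_card_le id)[e eS].
have /choice[g gP] a := bounded_on_segment regK (fun b => e b a) a.
by exists g => f /eS[b _ <-]; exists b => a /ltW; apply: gP.
Qed.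

Context (T : Type) (lt : T -> T -> Prop).
Hypothesis lt_wf : well_founded lt.
Hypothesis lt_trans : forall x y z, lt x y -> lt y z -> lt x z.
Hypothesis lt_total : forall x y, [\/ lt x y, x = y | lt y x].
Hypothesis lt_small : forall x, [set y | lt y x] #<= [set: K].

Lemma exists_increasing_chain :
  exists f : T -> K -> K, forall x y, lt x y -> eventually_lt (f x) (f y).
Proof.
have [|f fP] := @recursive_choice T (K -> K) lt
    (fun S g => forall h, S h -> eventually_lt h g) lt_wf.
  move=> x S Sx; apply: small_family_dominated.
  exact: card_le_trans Sx (lt_small x).
by exists f => x y xy; apply: fP; exists x.
Qed.

Lemma increasing_chain_injective (f : T -> K -> K) :
  (forall x y, lt x y -> eventually_lt (f x) (f y)) -> injective f.
Proof.
move=> finc x y fxy.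
have irr g : ~ eventually_lt g g.
  move=> [t tP]; have [a ta] := no_maximum regK t.
  by have := tP a ta; rewrite ltxx.
have [/finc|//|/finc] := lt_total x y; rewrite fxy => /irr[].
Qed.

Definition increasing_upto (W : K -> K -> Prop) (x : T) (h : T -> K) : Prop :=
  forall y z, lt y z -> z = x \/ lt z x -> W (h y) (h z).

(** In lieu of order types: send x to a W-minimal possible value at x of an
    embedding of {y | y <= x}. An embedding reaching y restricts to one
    reaching any x < y, with a W-smaller value, so the minimal values at x and
    y differ. *)
Lemma card_le_of_embeddings (W : K -> K -> Prop) :
  (forall A : set K, A !=set0 -> exists2 m, A m & forall i, A i -> ~ W i m) ->
  (forall x, exists h, increasing_upto W x h) ->
  [set: T] #<= [set: K].
Proof.
move=> Wmin emb.
have /choice[g gP] x : exists k,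
    [set h x | h in increasing_upto W x] k /\
    forall i, [set h x | h in increasing_upto W x] i -> ~ W i k.
  have [|k hk kmin] := Wmin [set h x | h in increasing_upto W x].
    by have [h hx] := emb x; exists (h x), h.
  by exists k.
have ginc x y : lt x y -> g x <> g y.
  move=> xy gxy; have [[h hy hyE] _] := gP y; have [_ gmin] := gP x.
  apply: (gmin (h x)); last by rewrite gxy -hyE; apply: hy => //; left.
  exists h => // u v uv vx; apply: hy => //; right.
  by case: vx => [->//|/lt_trans]; apply.
apply: (@card_le_injective _ _ g) => // x y gxy.
by have [/ginc|//|/ginc] := lt_total x y; rewrite gxy.
Qed.

Section LimitOrder.
Context (B : set K) (p : K -> K -> K).
Hypothesis statB : stationary B.
Hypothesis coh : forall x y, B x -> B y -> x < y ->
  forall i j, i < x -> j < x -> p x i < p x j <-> p y i < p y j.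

Definition limit_lt (i j : K) : Prop :=
  exists a, [/\ B a, i < a, j < a & p a i < p a j].

Lemma limit_ltE a i j : B a -> i < a -> j < a -> limit_lt i j -> p a i < p a j.
Proof.
move=> Ba ia ja [b [Bb ib jb pij]]; have [ab|ba|->//] := ltgtP a b.
  exact/(coh Ba Bb ab ia ja).
exact/(coh Bb Ba ba ib jb).
Qed.

(** A descending sequence is bounded in K by uncountable cofinality, so one
    point a of B sees all of it, as a descending sequence of values of p a. *)
Lemma limit_lt_minimum (A : set K) :
  A !=set0 -> exists2 m, A m & forall i, A i -> ~ limit_lt i m.
Proof.
move=> [i0 Ai0]; apply: contrapT => nomin.
have /choice[s sP] i : exists j, A i -> A j /\ limit_lt j i.
  have [Ai|nAi] := pselect (A i); last by exists i.
  apply: contrapT => nj; apply: nomin; exists i => // j Aj ji.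
  by apply: nj; exists j.
pose u n := iter n s i0.
have Au n : A (u n) by elim: n => // n /sP[].
have [b ub] := bounded_sequence regK u.
have [a Ba ba] := stationary_unbounded regK b statB.
have ua n : u n < a by apply: Order.POrderTheory.lt_trans (ub n) ba.
have [|_ [n _ <-] least] :=
  @regular_minimum _ _ regK [set p a (u n) | n in setT].
  by exists (p a (u 0%N)), 0%N.
have desc : p a (u n.+1) < p a (u n).
  by apply: limit_ltE => //; have [] := sP _ (Au n).
by have := least _ (ex_intro2 _ _ n.+1 I erefl); rewrite leNgt desc.
Qed.

End LimitOrder.

(** Capturing the whole chain would embed every initial segment of T into one
    well-founded relation on K, against the size of T. *)
Lemma increasing_chain_unbounded (f : T -> K -> K) :
  completely_ineffable K ->
  (forall x y, lt x y -> eventually_lt (f x) (f y)) ->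
  ~ ([set: T] #<= [set: K]) ->
  slalom_unbounded (range f).
Proof.
move=> [_ [R Rclass hom]] finc nTK phi; apply: contrapT => allcapt.
have capt x : captured (f x) phi.
  by apply: contrapT => nx; apply: allcapt; exists (f x); [exists x|].
have [x0 _] := inhabited_cardinal regK.
have /choice[p pP] a : exists e : K -> K,
    slalom_dom phi a -> slalom_val phi a `<=` e @` segment a.
  have [da|nda] := pselect (slalom_dom phi a); last by exists id.
  have := slalom_card da; rewrite card_eq_le.
  move=> /andP[/(cover_card_le x0)[e eP] _].
  by exists e.
have /choice[s sP] x : exists s, forall a, s < a ->
    exists2 i, i < a & p a i = f x a.
  have [b bP] := capt x; have [c cP] := slalom_dom_cobounded phi.
  exists (Order.max b c) => a; rewrite gt_max => /andP[ba ca].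
  have da : slalom_dom phi a.
    by apply: contrapT => /cP; rewrite leNgt ca.
  apply: (pP a da); apply: contrapT => nfa.
  by have : a <= b; [apply: bP|rewrite leNgt ba].
(* The well-founded relation is fixed here, before any point of T is. *)
have [[A RA] Rstat _] := Rclass.
have [B [RB _ cohB]] :=
  coherent_refinement regK Rclass hom (fun a i j => p a i < p a j) RA.
apply: nTK; apply: (@card_le_of_embeddings (limit_lt B p)).
  exact: limit_lt_minimum (Rstat _ RB) cohB.
move=> x.
have [e eP] := cover_card_le x (card_le_add_point regK x (lt_small x)).
have [B' [RB' B'B cohB']] :=
  coherent_refinement regK Rclass hom (fun a i j => p a i = f (e j) a) RB.
have /choice[idx idxP] y : exists j, y = x \/ lt y x -> e j = y.
  have [/eP[j _ ej]|ny] := pselect (y = x \/ lt y x); first by exists j.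
  by exists x0.
(* A single index k j describes f (e j) at all points of B' above j and k j:
   it is read off at one point and transported by coherence. *)
have /choice[k kP] j :
    exists i, exists a, [/\ B' a, i < a, j < a & p a i = f (e j) a].
  have [a B'a] := stationary_unbounded regK (Order.max j (s (e j))) (Rstat _ RB').
  rewrite gt_max => /andP[ja /sP[i ia pai]].
  by exists i, a.
have kE j a : B' a -> k j < a -> j < a -> p a (k j) = f (e j) a.
  move=> B'a ka ja; have [b [B'b kb jb pbk]] := kP j.
  have [ab|ba|->//] := ltgtP a b.
    exact/(cohB' a b B'a B'b ab _ _ ka ja).
  exact/(cohB' b a B'b B'a ba _ _ kb jb).
exists (k \o idx) => y z yz zx.
have yx : y = x \/ lt y x by right; case: zx => [<-//|]; apply: lt_trans yz.
have [t tP] := finc y z yz.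
have [a B'a] := stationary_unbounded regK
  (Order.max t (Order.max (Order.max (idx y) (idx z))
    (Order.max (k (idx y)) (k (idx z))))) (Rstat _ RB').
rewrite !gt_max => /and3P[ta /andP[ya za] /andP[kya kza]].
exists a; split=> //=; first exact: B'B.
by rewrite !kE // !idxP // tP.
Qed.

End Chain.

(** * The bounding number *)

Theorem corollary3p11 (d : Order.disp_t) (K : orderType d)
    (hK : completely_ineffable K) :
  exists F : set (K -> K),
    realizes_b_in_star K F /\ is_card_succ [set: K]%classic F.
Proof.
have [regK _] := hK.
have [T [lt [lt_wf lt_trans lt_total lt_small nTK]]] := exists_successor_order K.
have [f finc] := exists_increasing_chain regK lt_wf lt_small.
have FT : range f #<= [set: T] by apply: card_image_le.
have TF : [set: T] #<= range f.
  apply: (@card_le_injective _ _ f) => [|x]; last by exists x.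
  exact: (increasing_chain_injective regK lt_total finc).
have F_least (V : Type) (C : set V) : ~ (C #<= [set: K]) -> range f #<= C.
  move=> nCK; apply: card_le_trans FT _.
  apply: card_le_of_segments lt_wf lt_total _ => x Cx.
  exact: nCK (card_le_trans Cx (lt_small x)).
have nFK : ~ (range f #<= [set: K]) by move=> /(card_le_trans TF).
exists (range f); split; split.
- exact: (increasing_chain_unbounded regK lt_trans lt_total lt_small hK finc nTK).
- by move=> G /(slalom_unbounded_not_small regK); apply: F_least.
- split=> //; apply: card_le_of_segments (regular_wf regK) _ _ => [x y|x Fx].
    by case: (ltgtP x y) => ?; [constructor 1|constructor 3|constructor 2].
  by apply: nFK; apply: card_le_trans Fx _; apply: subset_card_le.
- by move=> V C [_ nCK]; apply: F_least.
Qed.
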